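(* For any $\beta\in(0,1)$ and any sufficiently small $\epsilon,\delta>0$ (how small depending only on $\beta$), no $(\epsilon,\delta)$-DP algorithm for the all-pairs shortest path distances problem can be $o(n^{1/6})$-accurate with probability $1-\beta$. That is, for every $\beta\in(0,1)$ there exist $\epsilon_0,\delta_0>0$ such that for all $\epsilon\in(0,\epsilon_0]$, $\delta\in(0,\delta_0]$ there is no function $\alpha(n)=o(n^{1/6})$ together with $(\epsilon,\delta)$-DP algorithms that, for every $n$, every $n$-vertex undirected graph $(V,E)$ and every weight vector $\mathbf{w}$, output estimates that are $\alpha(n)$-accurate with probability at least $1-\beta$.
   Context: A weighted undirected graph is $G=(V,E,\mathbf{w})$ with $n=|V|$ vertices and real (nonnegative) edge weights $\mathbf{w}\in\mathbb{R}^E$; $\mathrm{dist}_G(u,v)$ denotes the minimum total weight of a path from $u$ to $v$. The underlying graph $(V,E)$ is fixed and public; the private input is the weight vector $\mathbf{w}$, and two weight vectors $\mathbf{w},\mathbf{w}'$ on the same $(V,E)$ are neighbors if $\|\mathbf{w}-\mathbf{w}'\|_1\le 1$. A randomized algorithm $\mathcal{M}$ is $(\epsilon,\delta)$-DP if for all neighboring $\mathbf{w},\mathbf{w}'$ and every set $O$ of outputs, $\Pr[\mathcal{M}(\mathbf{w})\in O]\le e^{\epsilon}\Pr[\mathcal{M}(\mathbf{w}')\in O]+\delta$. In the all-pairs shortest path distances problem the algorithm outputs estimates $\tilde d(u,v)$ for all $u,v\in V$; the output is $\alpha$-accurate if $\max_{u,v\in V}|\mathrm{dist}_G(u,v)-\tilde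 d(u,v)|\le\alpha$. *)

(* Defs.v *)
From HB Require Import structures.
From mathcomp Require Import all_boot all_order all_algebra.
From mathcomp Require Import all_classical all_reals all_analysis.

Set Implicit Arguments.
Unset Strict Implicit.
Unset Printing Implicit Defensive.

Import Order.TTheory GRing.Theory Num.Theory.
Import numFieldNormedType.Exports.

Local Open Scope classical_set_scope.
Local Open Scope ring_scope.

(* Simple undirected graphs on the vertex set V; an edge is a 2-element set. *)
Record sgraph (V : finType) := SGraph {
  edges : {set {set V}};
  edgesP : forall a, a \in edges -> #|a| = 2%N }.

Definition edge (V : finType) (G : sgraph V) : finType :=
  {a : {set V} | a \in edges G}.

Definition adj (V : finType) (G : sgraph V) : rel V :=
  fun u v => [set u; v]%SET \in edges G.

Section WeightedGraph.
Context {R : realType} {V : finType} {G : sgraph V}.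
Implicit Types w : {ffun edge G -> R}.

Definition nonneg_weights w : Prop := forall a, 0 <= w a.

Definition neighbors w w' : Prop := \sum_(a : edge G) `|w a - w' a| <= 1.

(* The default 0 is only returned when u and v are not adjacent. *)
Definition pair_weight w (u v : V) : R :=
  if insub [set u; v]%SET is Some a then w a else 0.

(* Total weight of the walk u :: p. *)
Definition path_weight w (u : V) (p : seq V) : R :=
  \sum_(x <- pairmap (pair_weight w) u p) x.

Definition is_path (G : sgraph V) (u v : V) (p : seq V) : Prop :=
  [/\ path (adj G) u p, last u p = v & uniq (u :: p)].

(* There are finitely many simple paths, so the infimum is a minimum, except
   when v is not reachable from u, in which case it is +oo. *)
Definition dist w (u v : V) : \bar R :=
  ereal_inf [set (path_weight w u p)%:E | p in is_path G u v].

End WeightedGraph.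

(* The estimate of the distance from u to v is tnth (tnth d u) v. The library
   equips this type with the product of the Borel sigma-algebras. *)
Notation estimates R n := (n.-tuple (n.-tuple R)).

(* A pair of vertices in different components has infinite distance, which no
   real estimate approximates: the error is taken over the other pairs. *)
Definition accurate (R : realType) (n : nat) (G : sgraph 'I_n)
    (w : {ffun edge G -> R}) (alpha : R) : set (estimates R n) :=
  [set d | forall u v : 'I_n, (dist w u v < +oo)%E ->
     (`|dist w u v - (tnth (tnth d u) v)%:E| <= alpha%:E)%E].

(* Randomized algorithm on the public graph G: a weight vector is mapped to the
   law of the output. Only its values at nonnegative weights matter. *)
Definition algorithm (R : realType) (n : nat) (G : sgraph 'I_n) : Type :=
  {ffun edge G -> R} -> probability (estimates R n) R.

Definition DP (R : realType) (n : nat) (G : sgraph 'I_n) (eps delta : R)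
    (M : algorithm R G) : Prop :=
  forall w w' : {ffun edge G -> R},
    nonneg_weights w -> nonneg_weights w' -> neighbors w w' ->
    forall O : set (estimates R n), measurable O ->
      (M w O <= (expR eps)%:E * M w' O + delta%:E)%E.

(* Main.v *)
Require Import Defs.
From HB Require Import structures.
From mathcomp Require Import all_boot all_order all_algebra.
From mathcomp Require Import all_classical all_reals all_analysis.
From mathcomp Require Import zify ring lra.

Set Implicit Arguments.
Unset Strict Implicit.
Unset Printing Implicit Defensive.

Import Order.TTheory GRing.Theory Num.Theory.
Import numFieldNormedType.Exports.

Local Open Scope classical_set_scope.
Local Open Scope ring_scope.

(** The hard instance is the system of L^3 lines y = a + s i (a < L^2, s < L) on
    the grid of points (i, y) with i < L and y < 2 L^2, which has n = O(L^3)
    vertices. A point p is an edge carrying a private bit; points of consecutive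
    columns are joined by edges whose cost is quadratic in the slope, so that by
    strict convexity the shortest path between the two ends of a line is the line
    itself, and its length reveals, up to a public constant, the number of private
    bits on the line. An explicit dual potential certifies this.

    Let A be the incidence matrix of lines and points, x a uniformly random sign
    vector and M = A^T A. Since tr M = L^4, while tr M^2 <= 2 L^5 because two
    points lie on at most one line, typically |A x|^2 >= L^4 / 2 and
    |M x|^2 = O(L^5). From an output with error o(n^(1/6)) = o(sqrt L) one finds a
    typical x' with A x' close to A x; then <x, M x'> = <A x, A x'> >= L^4 / 4, so
    the vector a := M x', truncated at O(L) and rescaled to [-1, 1], satisfies
    <x, a> >= c #points with constant probability. Differential privacy makes the
    output nearly independent of each single sign, which bounds the expectation of
    <x, a>^2 by (e^eps - 1 + delta) (#points)^2 + #points, a contradiction. *)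

(** * Moments of uniformly random sign vectors *)

Section Signs.
Context {R : realFieldType} {I : finType}.
Implicit Types (x : {ffun I -> bool}) (i j k l : I).

Definition flip i x : {ffun I -> bool} := [ffun j => (i == j) (+) x j].

Definition chi x i : R := (-1) ^+ x i.

Lemma flipK i : involutive (flip i).
Proof. by move=> x; apply/ffunP=> j; rewrite !ffunE addKb. Qed.

Lemma chi_flip i x j : chi (flip i x) j = (-1) ^+ (i == j) * chi x j.
Proof. by rewrite /chi ffunE signr_addb. Qed.

Lemma chiE x i : chi x i = 1 - 2 * (x i)%:R.
Proof. by rewrite /chi; case: (x i); rewrite /= ?expr0 ?expr1; lra. Qed.

Lemma chi_sqr x i : chi x i * chi x i = 1.
Proof. by rewrite -expr2 sqrr_sign. Qed.

Lemma normr_chi x i : `|chi x i| = 1.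
Proof. by rewrite normr_sign. Qed.

Lemma sum_flip i (F : {ffun I -> bool} -> R) : \sum_x F (flip i x) = \sum_x F x.
Proof. by rewrite [RHS](reindex_inj (inv_inj (flipK i))). Qed.

Lemma sum_odd_flip i (F : {ffun I -> bool} -> R) :
  (forall x, F (flip i x) = - F x) -> \sum_x F x = 0.
Proof.
move=> oddF; have := sum_flip i F.
rewrite (eq_bigr (fun x => - F x)) // sumrN; lra.
Qed.

Lemma sum_chi2 i j :
  \sum_x chi x i * chi x j = (i == j)%:R * #|{ffun I -> bool}|%:R.
Proof.
have [->|ij] := eqVneq i j.
  by rewrite (eq_bigr (fun=> 1)) => [|x _]; rewrite ?chi_sqr // sumr_const mul1r.
rewrite mul0r; apply: (@sum_odd_flip i) => x.
by rewrite !chi_flip eqxx (negPf ij) expr1 expr0; ring.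
Qed.

(** An index that occurs only once kills the sum, by flipping its sign; only coinciding unordered
    pairs survive. *)
Lemma sum_chi4 i j k l : i != j -> k != l ->
  \sum_x (chi x i * chi x j) * (chi x k * chi x l)
   <= (((i == k) && (j == l))%:R + ((i == l) && (j == k))%:R)
      * #|{ffun I -> bool}|%:R.
Proof.
have odd_term a b c d : a != b -> a != c -> a != d ->
  \sum_x (chi x a * chi x b) * (chi x c * chi x d) = 0.
  move=> ab ac ad; apply: (@sum_odd_flip a) => x.
  by rewrite !chi_flip eqxx (negPf ab) (negPf ac) (negPf ad) expr1 expr0; ring.
have swap a b c d : \sum_x (chi x a * chi x b) * (chi x c * chi x d) =
                    \sum_x (chi x b * chi x a) * (chi x c * chi x d).
  by apply: eq_bigr => x _; ring.
have card_ge0 : 0 <= #|{ffun I -> bool}|%:R :> R by [].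
move=> ij kl; have [ik|ik] := eqVneq i k.
  have [jl|jl] := eqVneq j l.
    rewrite -ik -jl (negPf ij) /= addr0 mul1r.
    rewrite (eq_bigr (fun=> 1)) => [|x _]; first by rewrite sumr_const.
    by have := chi_sqr x i; have := chi_sqr x j; nra.
  rewrite swap odd_term // 1?eq_sym // -?ik // ?mulr_ge0 ?addr_ge0 //.
have [il|il] := eqVneq i l; last first.
  by rewrite odd_term // !add0r mul0r.
have [jk|jk] := eqVneq j k.
  rewrite -il -jk /= add0r mul1r (eq_bigr (fun=> 1)) => [|x _].
    by rewrite sumr_const.
  by have := chi_sqr x i; have := chi_sqr x j; nra.
by rewrite swap odd_term // 1?eq_sym // -?il // !add0r mul0r.
Qed.

Lemma sum_linear_sqr (c : I -> R) :
  \sum_x (\sum_i c i * chi x i) ^+ 2 = #|{ffun I -> bool}|%:R * \sum_i c i ^+ 2.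
Proof.
under eq_bigr do rewrite expr2 big_distrlr /=.
rewrite exchange_big mulr_sumr; apply: eq_bigr => i _.
rewrite exchange_big /= (bigD1 i) //= [X in _ + X]big1 ?addr0 => [|j ji].
  under eq_bigr do rewrite mulrACA.
  by rewrite -mulr_sumr sum_chi2 eqxx mul1r mulrC expr2.
under eq_bigr do rewrite mulrACA.
by rewrite -mulr_sumr sum_chi2 eq_sym (negPf ji) mul0r mulr0.
Qed.

(** Products of two distinct signs are orthogonal, except that an ordered pair also meets its
    transpose: hence the factor 2. *)
Lemma sum_quadratic_sqr (m : I -> I -> R) :
  (forall i j, 0 <= m i j) -> (forall i j, m i j = m j i) ->
  \sum_x (\sum_(e : I * I | e.1 != e.2) m e.1 e.2 * (chi x e.1 * chi x e.2)) ^+ 2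
   <= 2 * #|{ffun I -> bool}|%:R * \sum_i \sum_j m i j ^+ 2.
Proof.
move=> m_ge0 m_sym.
under eq_bigr do rewrite expr2 big_distrlr /=.
rewrite exchange_big [X in _ <= _ * X]pair_big /= mulr_sumr.
rewrite [leRHS](bigID (fun e => e.1 != e.2)) /=.
rewrite -[leLHS]addr0; apply: lerD; last first.
  by apply: sumr_ge0 => e _; rewrite mulr_ge0 ?sqr_ge0 ?mulr_ge0.
apply: ler_sum => -[i j] /= ij.
rewrite exchange_big /=.
have bound (f : I * I) : f.1 != f.2 ->
  \sum_x m i j * (chi x i * chi x j) * (m f.1 f.2 * (chi x f.1 * chi x f.2)) <=
   #|{ffun I -> bool}|%:R * m i j ^+ 2 * (f == (i, j))%:R +
   #|{ffun I -> bool}|%:R * m i j ^+ 2 * (f == (j, i))%:R.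
  case: f => k l /= kl.
  under eq_bigr do rewrite mulrACA.
  rewrite -mulr_sumr.
  apply: le_trans (ler_wpM2l _ (sum_chi4 ij kl)) _; first exact: mulr_ge0.
  rewrite !xpair_eqE ![k == _]eq_sym ![l == _]eq_sym andbC.
  rewrite [(j == k) && (i == l)]andbC.
  case: andP => [[/eqP jl /eqP ik]|_]; case: andP => [[/eqP il /eqP jk]|_];
    rewrite ?jl ?ik ?il ?jk ?(m_sym l k) ?(m_sym k l) /=; lra.
apply: le_trans (ler_sum _ bound) _.
rewrite big_split /= -!mulr_sumr.
have one g : \sum_(f : I * I | f.1 != f.2) (f == g)%:R <= 1 :> R.
  rewrite big_mkcond (bigD1 g) //= eqxx big1 => [|f /negPf ->]; last by case: ifP.
  by rewrite addr0; case: ifP.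
have := one (i, j); have := one (j, i).
set a := \sum_(_ | _) _; set b := \sum_(_ | _) _ => ha hb.
have c_ge0 : 0 <= #|{ffun I -> bool}|%:R * m i j ^+ 2 by rewrite mulr_ge0 ?sqr_ge0.
nra.
Qed.

End Signs.

(** * Privacy limits the correlation of outputs with private signs *)

Section Correlation.
Context {R : realFieldType} {I K : finType}.

(* Squaring the correlation makes the outputs that are not accurate contribute
   nonnegatively; this is what allows a failure probability close to 1. *)
Lemma private_correlation (P : {ffun I -> bool} -> K -> R) (a : K -> I -> R)
    (tau : R) :
  0 <= tau -> (forall x k, 0 <= P x k) -> (forall x, \sum_k P x k <= 1) ->
  (forall x i, \sum_k `|P x k - P (flip i x) k| <= 2 * tau) ->
  (forall k i, `|a k i| <= 1) ->
  \sum_x \sum_k P x k * (\sum_i chi x i * a k i) ^+ 2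
   <= #|{ffun I -> bool}|%:R * (tau * #|I|%:R ^+ 2 + #|I|%:R).
Proof.
move=> tau0 P0 P1 Pflip a1.
have aa k i j : `|a k i * a k j| <= 1 by rewrite normrM mulr_ile1.
pose T i j := \sum_x \sum_k P x k * (chi x i * chi x j * (a k i * a k j)).
have -> : \sum_x \sum_k P x k * (\sum_i chi x i * a k i) ^+ 2 =
          \sum_i \sum_j T i j.
  have E x k : P x k * (\sum_i chi x i * a k i) ^+ 2 =
    \sum_i \sum_j P x k * (chi x i * chi x j * (a k i * a k j)).
    rewrite expr2 big_distrlr /= mulr_sumr; apply: eq_bigr => i _.
    by rewrite mulr_sumr; apply: eq_bigr => j _; rewrite [in RHS]mulrACA.
  under eq_bigr do under eq_bigr do rewrite E.
  under eq_bigr do rewrite exchange_big /=.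
  rewrite exchange_big /=; apply: eq_bigr => i _.
  under eq_bigr do rewrite exchange_big /=.
  by rewrite exchange_big.
have Tij i j : T i j <= #|{ffun I -> bool}|%:R * ((i == j)%:R + tau).
  have [<-|ij] := eqVneq i j.
    apply: (@le_trans _ _ (\sum_(x : {ffun I -> bool}) 1)).
      apply: ler_sum => x _; apply: le_trans (P1 x); apply: ler_sum => k _.
      rewrite chi_sqr mul1r -[leRHS]mulr1 ler_wpM2l //.
      exact: le_trans (ler_norm _) (aa _ _ _).
    rewrite sumr_const; have : 0 <= #|{ffun I -> bool}|%:R :> R by [].
    by rewrite mulrDr mulr1; nra.
  (* Flipping [i] negates the product of the signs at [i] and [j], so adding [T i j] to its flipped
     form leaves only differences of output probabilities. *)
  have T2 : 2 * T i j = \sum_x \sum_k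
     (P x k - P (flip i x) k) * (chi x i * chi x j * (a k i * a k j)).
    have -> : 2 * T i j = T i j + T i j by ring.
    rewrite {2}/T -(sum_flip i) -big_split; apply: eq_bigr => x _ /=.
    rewrite -big_split; apply: eq_bigr => k _ /=.
    by rewrite !chi_flip eqxx (negPf ij) expr1 expr0; ring.
  suff : 2 * T i j <= 2 * (#|{ffun I -> bool}|%:R * tau) by rewrite add0r; lra.
  rewrite T2; apply: (@le_trans _ _ (\sum_(x : {ffun I -> bool}) 2 * tau)).
    apply: ler_sum => x _; apply: le_trans (Pflip x i); apply: ler_sum => k _.
    apply: le_trans (ler_norm _) _; rewrite !normrM !normr_chi !mul1r -normrM.
    by rewrite -[leRHS]mulr1 ler_wpM2l.
  by rewrite sumr_const -mulr_natr; lra.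
apply: le_trans (ler_sum _ (fun i _ => ler_sum _ (fun j _ => Tij i j))) _.
under eq_bigr do rewrite -mulr_sumr big_split /= sumr_const.
rewrite -mulr_sumr big_split /= sumr_const.
rewrite (eq_bigr (fun=> 1)) => [|i _]; last first.
  rewrite (bigD1 i) //= eqxx big1 ?addr0 // => j ji.
  by rewrite eq_sym (negPf ji).
rewrite sumr_const -mulrnA -[tau *+ _]mulr_natr natrM ler_wpM2l //.
by rewrite addrC expr2.
Qed.

End Correlation.

Lemma markov_card (R : realFieldType) (T : finType) (f : T -> R) (b : R)
    (B : pred T) :
  0 < b -> (forall x, 0 <= f x) -> (forall x, B x -> b <= f x) ->
  #|B|%:R * b <= \sum_x f x.
Proof.
move=> b0 f0 Bf; rewrite (bigID B) /= -[leLHS]addr0.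
apply: lerD; last by apply: sumr_ge0.
rewrite mulr_natl -sumr_const; apply: ler_sum => x; exact: Bf.
Qed.

(** * Reconstruction of signs from approximate linear answers *)

Section Reconstruction.
Context {R : realFieldType} {I Q K : finType}.
Variable A : Q -> I -> R.
Implicit Types x y : {ffun I -> bool}.

Definition gram i j := \sum_q A q i * A q j.

Definition answer x q := \sum_i A q i * chi x i.

Definition energy x := \sum_q answer x q ^+ 2.

Definition backproj x i := \sum_j gram i j * chi x j.

Lemma dot_backproj x y :
  \sum_i chi x i * backproj y i = \sum_q answer x q * answer y q.
Proof.
under [RHS]eq_bigr do rewrite /answer big_distrlr /=.
rewrite exchange_big; apply: eq_bigr => i _ /=.
rewrite exchange_big mulr_sumr; apply: eq_bigr => j _ /=.
rewrite /gram mulr_suml mulr_sumr; apply: eq_bigr => q _; ring.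
Qed.

(** Squares of signs are 1, so the energy splits into its mean, the trace, and a fluctuation of mean
    zero. *)
Lemma energyE x : energy x = \sum_i gram i i +
  \sum_(e : I * I | e.1 != e.2) gram e.1 e.2 * (chi x e.1 * chi x e.2).
Proof.
have -> : energy x = \sum_i chi x i * backproj x i.
  by rewrite dot_backproj; apply: eq_bigr => q _; rewrite expr2.
have -> : \sum_i chi x i * backproj x i =
          \sum_(e : I * I) gram e.1 e.2 * (chi x e.1 * chi x e.2).
  rewrite -(pair_bigA _ (fun i j => gram i j * (chi x i * chi x j))).
  apply: eq_bigr => i _.
  by rewrite mulr_sumr; apply: eq_bigr => j _; ring.
rewrite (bigID (fun e : I * I => e.1 != e.2)) /= addrC; congr (_ + _).
rewrite (reindex (fun i => (i, i))) /=.
  by apply: eq_big => [i|i _]; rewrite ?eqxx // chi_sqr mulr1.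
by exists fst => [i|[i j]] //=; rewrite !inE negbK /= => /eqP ->.
Qed.

(** [p] bounds the success probability from below, [tau] the effect of one sign on the output law in
    total variation, [rho] the gap between answers of vectors consistent with one output. *)
Variables (ell p tau rho : R) (P : {ffun I -> bool} -> K -> R)
  (consistent : K -> {ffun I -> bool} -> bool).
Hypotheses (ell_gt0 : 0 < ell) (p_gt0 : 0 < p) (p_le1 : p <= 1)
  (tau_ge0 : 0 <= tau).
Hypotheses (A_ge0 : forall q i, 0 <= A q i) (cardI : #|I|%:R = 2 * ell ^+ 3)
  (cardQ : #|Q|%:R = ell ^+ 3) (trace_gram : \sum_i gram i i = ell ^+ 4)
  (gram_sqr : \sum_i \sum_j gram i j ^+ 2 <= 2 * ell ^+ 5).
Hypotheses (P_ge0 : forall x k, 0 <= P x k) (P_le1 : forall x, \sum_k P x k <= 1)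
  (P_flip : forall x i, \sum_k `|P x k - P (flip i x) k| <= 2 * tau).
Hypotheses (consistent_close : forall k x y q, consistent k x -> consistent k y ->
     `|answer x q - answer y q| <= rho)
  (rho_small : rho ^+ 2 <= ell / 2)
  (P_consistent : forall x, p <= \sum_(k | consistent k x) P x k).
Hypothesis ell_large : 64 <= p * ell ^+ 3.

(** High energy forces correlation; the bound on the backprojection limits what truncation loses. *)
Definition typical x : bool :=
  (ell ^+ 4 / 2 <= energy x)
  && (\sum_i backproj x i ^+ 2 <= 8 / p * ell ^+ 5).

Let N : R := #|{ffun I -> bool}|%:R.

Let N_ge0 : 0 <= N. Proof. by rewrite /N. Qed.

(** Chebyshev: the mean is [ell ^+ 4] and the variance at most [4 * ell ^+ 5], so the proportion is
    at most [16 / ell ^+ 3], which [ell_large] turns into [p / 4]. *)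
Lemma card_low_energy :
  #|[pred x | energy x < ell ^+ 4 / 2]|%:R <= p / 4 * N.
Proof.
set B := #|_|%:R.
have l3 : 0 < ell ^+ 3 by rewrite exprn_gt0.
have l4 : 0 < ell ^+ 4 by rewrite exprn_gt0.
have l5 : 0 < ell ^+ 5 by rewrite exprn_gt0.
have g_ge0 i j : 0 <= gram i j by apply: sumr_ge0 => q _; rewrite mulr_ge0.
have g_sym i j : gram i j = gram j i by apply: eq_bigr => q _; rewrite mulrC.
have := sum_quadratic_sqr g_ge0 g_sym; rewrite -/N.
have := @markov_card R _ (fun x => (\sum_(e : I * I | e.1 != e.2)
  gram e.1 e.2 * (chi x e.1 * chi x e.2)) ^+ 2) (ell ^+ 8 / 4)
  [pred x | energy x < ell ^+ 4 / 2].
rewrite -/B => /(_ _ _ _) M V.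
have {M V} : B * (ell ^+ 8 / 4) <= 2 * N * (2 * ell ^+ 5).
  apply: le_trans (M _ _ _) (le_trans V _).
  - by rewrite divr_gt0 ?exprn_gt0.
  - by move=> x; rewrite sqr_ge0.
  - move=> x; rewrite /= energyE trace_gram; set o := \sum_(_ | _) _ => ho.
    have -> : ell ^+ 8 = ell ^+ 4 * ell ^+ 4 by rewrite -exprD.
    by rewrite expr2; nra.
  by rewrite ler_wpM2l // mulr_ge0.
have -> : ell ^+ 8 = ell ^+ 5 * ell ^+ 3 by rewrite -exprD.
move=> H; have {H} : B * ell ^+ 3 <= 16 * N.
  by rewrite -(ler_pM2l l5); nra.
move=> H; have B0 : 0 <= B by rewrite /B.
rewrite -(ler_pM2r l3).
have : N * 64 <= N * (p * ell ^+ 3) by rewrite ler_wpM2l.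
nra.
Qed.

(** Markov: by orthogonality of the signs, the mean squared norm is the squared Frobenius norm of
    the Gram matrix. *)
Lemma card_large_backproj :
  #|[pred x | 8 / p * ell ^+ 5 < \sum_i backproj x i ^+ 2]|%:R <= p / 4 * N.
Proof.
set B := #|_|%:R.
have l5 : 0 < ell ^+ 5 by rewrite exprn_gt0.
have b0 : 0 < 8 / p * ell ^+ 5 by rewrite mulr_gt0 ?divr_gt0.
have : B * (8 / p * ell ^+ 5) <= N * (2 * ell ^+ 5).
  apply: le_trans (markov_card (f := fun x => \sum_i backproj x i ^+ 2) b0 _ _) _.
  - by move=> x; apply: sumr_ge0 => i _; rewrite sqr_ge0.
  - by move=> x /ltW.
  rewrite exchange_big /=; under eq_bigr do rewrite sum_linear_sqr -/N.
  by rewrite -mulr_sumr ler_wpM2l.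
move=> H; have {}H : B * (8 / p) <= N * 2 by rewrite -(ler_pM2r l5); lra.
rewrite -(ler_pM2r (x := 8 / p)) ?divr_gt0 //.
by have -> : p / 4 * N * (8 / p) = N * 2 by field; rewrite gt_eqF.
Qed.

Lemma card_typical : N / 2 <= #|typical|%:R.
Proof.
have /(ler_wpM2r N_ge0) := p_le1; rewrite mul1r => pN.
have := card_low_energy; have := card_large_backproj.
set B1 := [pred x | _]; set B2 := [pred x | _] => h1 h2.
suff : N <= #|typical|%:R + (#|B1|%:R + #|B2|%:R) by lra.
rewrite -!natrD /N ler_nat -(cardC typical) leq_add2l.
rewrite -cardUI; apply: leq_trans (leq_addr _ _); apply: subset_leq_card.
apply/fintype.subsetP => x; rewrite !inE /= -!topredE /= /typical negb_and -!ltNge.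
by rewrite orbC.
Qed.

(** This threshold makes the truncation loss at most half of the guaranteed correlation
    [ell ^+ 4 / 4]. *)
Let cut := 64 / p * ell.

Definition score x i : R :=
  if `|backproj x i| <= cut then backproj x i / cut else 0.

(** The attack sees only [k] and picks any typical vector consistent with it. *)
Definition score_of (k : K) i : R :=
  if [pick x | consistent k x && typical x] is Some x then score x i else 0.

Let cut_gt0 : 0 < cut. Proof. by rewrite mulr_gt0 ?divr_gt0. Qed.

Lemma score_le1 x i : `|score x i| <= 1.
Proof.
rewrite /score; case: ifP; rewrite ?normr0 // normrM normfV (gtr0_norm cut_gt0).
by rewrite ler_pdivrMr // mul1r.
Qed.

Lemma score_correlated k x y :
  consistent k x -> consistent k y -> typical x -> typical y ->
  p * ell ^+ 3 / 512 <= \sum_i chi x i * score y i.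
Proof.
move=> kx ky /andP[ex _] /andP[ey by_].
have l3 : 0 < ell ^+ 3 by rewrite exprn_gt0.
have close : \sum_q (answer x q - answer y q) ^+ 2 <= ell ^+ 4 / 2.
  apply: (@le_trans _ _ (\sum_(q : Q) ell / 2)).
    apply: ler_sum => q _; apply: le_trans rho_small.
    have d := consistent_close q kx ky.
    have rho_ge0 := le_trans (normr_ge0 _) d.
    by rewrite -real_normK ?num_real // lerXn2r ?nnegrE.
  by rewrite sumr_const -[leLHS]mulr_natr cardQ -[4%N]/(1 + 3)%N exprD expr1; lra.
have dot : ell ^+ 4 / 4 <= \sum_i chi x i * backproj y i.
  rewrite dot_backproj.
  (* Polarization: each energy is at least [ell ^+ 4 / 2], the distance term at most that. *)
  suff : energy x + energy y - \sum_q (answer x q - answer y q) ^+ 2 =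
         2 * \sum_q answer x q * answer y q by lra.
  rewrite /energy -big_split -sumrB mulr_sumr; apply: eq_bigr => q _ /=; ring.
(* Below the cut nothing is lost; above it, [|b| / cut <= b ^+ 2 / cut ^+ 2], so the squared norm
   controls the loss. *)
have trunc i : chi x i * backproj y i / cut - backproj y i ^+ 2 / cut ^+ 2
               <= chi x i * score y i.
  rewrite /score; have [le|gt] := lerP `|backproj y i| cut.
    rewrite mulrA lerBlDr lerDl divr_ge0 ?sqr_ge0 //.
  rewrite mulr0 subr_le0 -real_normK ?num_real //.
  apply: le_trans (ler_norm _) _; rewrite !normrM normr_chi mul1r normfV.
  rewrite (gtr0_norm cut_gt0) ler_pdivrMr //.
  have -> : `|backproj y i| ^+ 2 / cut ^+ 2 * cut = `|backproj y i| ^+ 2 / cut.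
    by field; rewrite gt_eqF.
  by rewrite ler_pdivlMr // expr2 ler_wpM2l // ltW.
apply: le_trans (ler_sum _ (fun i _ => trunc i)).
rewrite sumrB -!mulr_suml lerBrDr.
(* The main term equals [p * ell ^+ 3 / 256], and the loss is at most half of it. *)
apply: (@le_trans _ _ (ell ^+ 4 / 4 / cut)); last first.
  by rewrite ler_wpM2r // invr_ge0 ltW.
apply: (@le_trans _ _ (p * ell ^+ 3 / 512 + 8 / p * ell ^+ 5 / cut ^+ 2)).
  by rewrite lerD2l ler_wpM2r // invr_ge0 exprn_ge0 // ltW.
rewrite le_eqVlt; apply/orP; left; apply/eqP; rewrite /cut.
by field; rewrite ?gt_eqF.
Qed.

(** At least half of the vectors are typical, and each yields with probability [p] a squared
    correlation of at least [c]; privacy bounds the total from above. The constant [2 ^+ 19] is 2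
    times the square of 512. *)
Lemma reconstruction_bound :
  p ^+ 3 / 2 ^+ 19 * ell ^+ 3 <= 4 * tau * ell ^+ 3 + 2.
Proof.
have l3 : 0 < ell ^+ 3 by rewrite exprn_gt0.
have sc k i : `|score_of k i| <= 1.
  by rewrite /score_of; case: pickP => [x _|_]; rewrite ?normr0 ?score_le1.
have := private_correlation tau_ge0 P_ge0 P_le1 P_flip sc.
rewrite -/N cardI => up.
have b_gt0 : 0 < p * ell ^+ 3 / 512.
  by apply: divr_gt0; [exact: mulr_gt0 | rewrite ltr0n].
pose c := (p * ell ^+ 3 / 512) ^+ 2.
have c_ge0 : 0 <= c by rewrite sqr_ge0.
have N_gt0 : 0 < N by rewrite /N ltr0n; apply/card_gt0P; exists [ffun=> true].
have low : N / 2 * (p * c) <=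
  \sum_x \sum_k P x k * (\sum_i chi x i * score_of k i) ^+ 2.
  apply: le_trans (_ : #|typical|%:R * (p * c) <= _).
    by rewrite ler_wpM2r ?card_typical // mulr_ge0 // ltW.
  apply: markov_card => [|x|x tx].
  - by rewrite mulr_gt0 // exprn_gt0.
  - by apply: sumr_ge0 => k _; rewrite mulr_ge0 ?sqr_ge0.
  apply: le_trans (_ : (\sum_(k | consistent k x) P x k) * c <= _).
    by rewrite ler_wpM2r.
  rewrite mulr_suml [leRHS](bigID (fun k => consistent k x)) /= -[leLHS]addr0.
  apply: lerD; last by apply: sumr_ge0 => k _; rewrite mulr_ge0 ?sqr_ge0.
  apply: ler_sum => k kx; rewrite ler_wpM2l // /score_of.
  case: pickP => [y /andP[ky ty]|/(_ x)]; last by rewrite kx [typical x]tx.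
  have := score_correlated kx ky tx ty.
  move=> h; have b_ge0 := ltW b_gt0.
  by rewrite lerXn2r ?nnegrE // (le_trans b_ge0 h).
have := le_trans low up; rewrite -mulrA (ler_pM2l N_gt0) /c.
set L := ell ^+ 3 => H.
have {}H : L * (p ^+ 3 / 2 ^+ 19 * L) <= L * (4 * tau * L + 2).
  have -> : L * (p ^+ 3 / 2 ^+ 19 * L) = 2^-1 * (p * (p * L / 512) ^+ 2) by field.
  by apply: le_trans H _; rewrite le_eqVlt; apply/orP; left; apply/eqP; field.
by rewrite -(ler_pM2l l3).
Qed.

End Reconstruction.

(** * From differential privacy to finitely many outputs *)

Lemma total_variation_dp (R : realFieldType) (K : finType) (mu nu : K -> R)
    (e delta : R) :
  1 <= e -> \sum_k mu k <= 1 -> \sum_k nu k <= 1 ->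
  (forall k, 0 <= mu k) -> (forall k, 0 <= nu k) ->
  (forall S : pred K, \sum_(k | S k) mu k <= e * \sum_(k | S k) nu k + delta) ->
  (forall S : pred K, \sum_(k | S k) nu k <= e * \sum_(k | S k) mu k + delta) ->
  \sum_k `|mu k - nu k| <= 2 * (e - 1 + delta).
Proof.
move=> e1 mu1 nu1 mu0 nu0 dp1 dp2.
(* The l1 distance is the sum of two surpluses, on the set where [mu] dominates and on its
   complement; privacy bounds each. *)
have half (a b : K -> R) : (forall k, 0 <= b k) -> \sum_k b k <= 1 ->
    (forall S : pred K, \sum_(k | S k) a k <= e * \sum_(k | S k) b k + delta) ->
  forall S : pred K, \sum_(k | S k) (a k - b k) <= e - 1 + delta.
  move=> b0 b1 dp S; rewrite sumrB; have := dp S.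
  have : \sum_(k | S k) b k <= 1.
    apply: le_trans b1; rewrite [leRHS](bigID S) /= lerDl.
    by apply: sumr_ge0.
  nra.
have h1 := half _ _ nu0 nu1 dp1 (fun k => nu k <= mu k).
have h2 := half _ _ mu0 mu1 dp2 (fun k => ~~ (nu k <= mu k)).
rewrite (bigID (fun k => nu k <= mu k)) /=.
rewrite (eq_bigr (fun k => mu k - nu k)) => [|k le]; last by rewrite ger0_norm ?subr_ge0.
rewrite [X in _ + X](eq_bigr (fun k => nu k - mu k)) => [|k]; last first.
  by rewrite -ltNge => lt; rewrite ltr0_norm ?subr_lt0 // opprB.
lra.
Qed.

Section FiniteImage.
Context {R : realType} {d : measure_display} {T : measurableType d} {K : finType}.
Variable f : T -> K.
Hypothesis mf : forall k, measurable (f @^-1` [set k]).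

Lemma preimage_finE (S : pred K) :
  f @^-1` [set k | S k] = \bigcup_(k in [set` enum S]) f @^-1` [set k].
Proof.
apply/seteqP; split => t /=.
  by move=> ft; exists (f t) => //=; rewrite mem_enum.
by move=> [k /=]; rewrite mem_enum => Sk ->.
Qed.

Lemma measurable_preimage_fin (S : pred K) : measurable (f @^-1` [set k | S k]).
Proof.
by rewrite preimage_finE; apply: fin_bigcup_measurable => //; exact: finite_seq.
Qed.

Lemma probability_preimage_fin (mu : probability T R) (S : pred K) :
  mu (f @^-1` [set k | S k]) =
  (\sum_(k | S k) fine (mu (f @^-1` [set k])))%:E.
Proof.
rewrite preimage_finE measure_fin_bigcup //; last by move=> i j _ _ [t [/= <- <-]].
rewrite -fsbig_seq ?enum_uniq // big_enum /= -sumEFin; apply: eq_bigr => k _.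
by rewrite fineK // fin_num_measure.
Qed.

End FiniteImage.

Lemma measurable_accurate (R : realType) (n : nat) (G : sgraph 'I_n)
    (w : {ffun edge G -> R}) (alpha : R) : measurable (accurate w alpha).
Proof.
have -> : accurate w alpha = \bigcap_(u in [set: 'I_n]) \bigcap_(v in [set: 'I_n])
  [set d | (dist w u v < +oo)%E ->
     (`|dist w u v - (tnth (tnth d u) v)%:E| <= alpha%:E)%E].
  apply/seteqP; split => t /=; first by move=> h u _ v _; exact: h.
  by move=> h u v; exact: h.
apply: fin_bigcap_measurable => [|u _]; first exact: finite_finset.
apply: fin_bigcap_measurable => [|v _]; first exact: finite_finset.
have mt : measurable_fun [set: estimates R n] (fun d => tnth (tnth d u) v).
  apply: (@measurableT_comp _ _ _ _ _ _ (fun t : n.-tuple R => tnth t v)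
           _ (fun d : estimates R n => tnth d u)); exact: measurable_tnth.
(* At [+oo] nothing is asked of the estimate; at [-oo] no real estimate qualifies. *)
case: (dist w u v) => [r| |].
- have := mt measurableT `[r - alpha, r + alpha]%classic (measurable_itv _).
  rewrite setTI; congr measurable; apply/seteqP; split => d /=.
    by rewrite in_itv /= => h _; rewrite lee_fin ler_distlC.
  by move=> /(_ (ltry r)); rewrite lee_fin ler_distlC in_itv.
- rewrite [X in measurable X](_ : _ = setT); first exact: measurableT.
  by apply/seteqP; split.
- rewrite [X in measurable X](_ : _ = set0); first exact: measurable0.
  by apply/seteqP; split => // d /(_ isT).
Qed.

(** Recording only the set of bit vectors for which an output is accurate is a post-processing with
    finite range, so it preserves privacy. *)
Lemma dp_finite_outputs (R : realType) (n : nat) (G : sgraph 'I_n)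
    (M : algorithm R G) (eps delta alpha p : R) (I : finType)
    (w : {ffun I -> bool} -> {ffun edge G -> R}) :
  0 <= eps -> DP eps delta M ->
  (forall x, nonneg_weights (w x)) ->
  (forall x i, neighbors (w x) (w (flip i x))) ->
  (forall x, (p%:E <= M (w x) (accurate (w x) alpha))%E) ->
  exists (P : {ffun I -> bool} -> {set {ffun I -> bool}} -> R)
         (consistent : {set {ffun I -> bool}} -> {ffun I -> bool} -> bool),
    [/\ forall x k, 0 <= P x k, forall x, \sum_k P x k <= 1,
        forall x i, \sum_k `|P x k - P (flip i x) k|
                     <= 2 * (expR eps - 1 + delta),
        forall k x y, consistent k x -> consistent k y ->
          exists d, accurate (w x) alpha d /\ accurate (w y) alpha d &
        forall x, p <= \sum_(k | consistent k x) P x k].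
Proof.
move=> eps0 dpM w0 wflip acc.
pose f (d : estimates R n) := [set x | `[< accurate (w x) alpha d >]]%SET.
have mf k : measurable (f @^-1` [set k]).
  have -> : f @^-1` [set k] = \bigcap_(x in [set: {ffun I -> bool}])
      (if x \in k then accurate (w x) alpha else ~` accurate (w x) alpha).
    apply/seteqP; split => d /=.
      by move=> <- x _; rewrite inE; case: asboolP.
    move=> h; apply/setP => x; rewrite inE; have := h x Logic.I.
    by case: ifP => xk hx; apply/asboolP.
  apply: fin_bigcap_measurable => [|x _]; first exact: finite_finset.
  by case: ifP => _; [|apply: measurableC]; exact: measurable_accurate.
pose P x k := fine (M (w x) (f @^-1` [set k])).
have PE x (S : pred {set {ffun I -> bool}}) :
    M (w x) (f @^-1` [set k | S k]) = (\sum_(k | S k) P x k)%:E.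
  exact: probability_preimage_fin.
have P0 x k : 0 <= P x k by rewrite fine_ge0.
have P1 x : \sum_k P x k <= 1.
  by rewrite -lee_fin -(PE x xpredT) probability_le1 //; exact: measurable_preimage_fin.
(* Besides [x \in k], this says that some output has code [k]; that output serves two consistent
   vectors at once. *)
exists P, (fun k x => `[< exists2 d, f d = k & accurate (w x) alpha d >]).
split=> //.
- have dpP x x' (S : pred {set {ffun I -> bool}}) : neighbors (w x) (w x') ->
    \sum_(k | S k) P x k <= expR eps * \sum_(k | S k) P x' k + delta.
    move=> nb; rewrite -lee_fin EFinD EFinM -!PE.
    by apply: dpM => //; exact: measurable_preimage_fin.
  move=> x i; apply: total_variation_dp => //.
  + by rewrite -expR0 ler_expR.
  + by move=> S; exact: dpP.
  + by move=> S; apply: dpP; rewrite -{2}(flipK i x).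
- move=> k x y /asboolP[d fd ax] /asboolP[d' fd' ay]; exists d; split=> //.
  have : y \in f d' by rewrite inE; apply/asboolP.
  by rewrite fd' -fd inE => /asboolP.
- move=> x; rewrite -lee_fin -PE; apply: le_trans (acc x) _.
  rewrite le_eqVlt; apply/orP; left; apply/eqP; congr (M (w x) _).
  apply/seteqP; split => d /=.
    by move=> ax; apply/asboolP; exists d.
  move=> /asboolP[d' fd' ax]; have : x \in f d' by rewrite inE; apply/asboolP.
  by rewrite fd' inE => /asboolP.
Qed.

(** * Shortest paths certified by potentials *)

Section Geodesics.
Context {R : realType} {V : finType} {G : sgraph V} (w : {ffun edge G -> R}).

Lemma path_weight_cons u v p :
  path_weight w u (v :: p) = pair_weight w u v + path_weight w v p.
Proof. by rewrite /path_weight /= big_cons. Qed.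

Variable F : V -> R.
Hypothesis feasible : forall u v, adj G u v -> F v - F u <= pair_weight w u v.

Lemma potential_le_path_weight u p :
  path (adj G) u p -> F (last u p) - F u <= path_weight w u p.
Proof.
elim: p u => [|v p IH] u /=; first by rewrite subrr /path_weight big_nil.
by case/andP=> /feasible uv /IH; rewrite path_weight_cons; lra.
Qed.

Variables (f : nat -> V) (m : nat).
Hypotheses (f_inj : forall i j, (i <= m)%N -> (j <= m)%N -> f i = f j -> i = j)
  (f_adj : forall i, (i < m)%N -> adj G (f i) (f i.+1))
  (f_tight : forall i, (i < m)%N ->
     pair_weight w (f i) (f i.+1) = F (f i.+1) - F (f i)).

(** Duality: a feasible potential bounds every path from below by telescoping, and a path of tight
    edges attains the bound. *)
Lemma dist_tight_path : dist w (f 0%N) (f m) = (F (f m) - F (f 0%N))%:E.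
Proof.
pose p := [seq f i | i <- iota 1 m].
have walk k i : (i + k <= m)%N ->
  [/\ path (adj G) (f i) [seq f j | j <- iota i.+1 k],
      last (f i) [seq f j | j <- iota i.+1 k] = f (i + k)%N &
      path_weight w (f i) [seq f j | j <- iota i.+1 k] = F (f (i + k)%N) - F (f i)].
  elim: k i => [|k IH] i ikm /=.
    by rewrite addn0 subrr /path_weight big_nil.
  have im : (i < m)%N by lia.
  have [|h1 h2 h3] := IH i.+1; first by lia.
  rewrite path_weight_cons h3 h2 f_adj // f_tight // addSnnS; split=> //; ring.
have [//|pP pl pw] := walk m 0%N.
apply/le_anti/andP; split.
  rewrite -pw; apply: ereal_inf_lbound; exists p => //; split=> //.
  rewrite -[f 0%N :: p]/[seq f i | i <- iota 0 m.+1] map_inj_in_uniq ?iota_uniq //.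
  by move=> i j; rewrite !mem_iota => /andP[_ im] /andP[_ jm]; apply: f_inj; lia.
apply: le_ereal_inf_tmp => _ [q [qP ql _] <-]; rewrite lee_fin -ql.
exact: potential_le_path_weight.
Qed.

End Geodesics.

(** * Undirected graphs from oriented arcs *)

Section ArcGraph.
Context {R : realType} {V : finType} (arc : rel V).
Hypothesis arc_asym : forall u v, arc u v -> ~~ arc v u.

Let arc_edges := [set [set e.1; e.2] | e in [set e : V * V | arc e.1 e.2]]%SET.

Lemma arc_irrefl u : arc u u = false.
Proof. by case uu: (arc u u) => //; have := arc_asym uu; rewrite uu. Qed.

Lemma set2_arc a b u v : arc a b -> [set a; b]%SET = [set u; v]%SET ->
  (a, b) = (u, v) \/ (a, b) = (v, u).
Proof.
move=> ab E.
have : a \in [set u; v]%SET by rewrite -E set21.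
have : b \in [set u; v]%SET by rewrite -E set22.
by rewrite !inE => /orP[] /eqP bE /orP[] /eqP aE; move: ab; rewrite aE bE
  ?arc_irrefl //; auto.
Qed.

Fact arc_edgesP (a : {set V}) : a \in arc_edges -> #|a| = 2%N.
Proof.
case/imsetP=> -[u v]; rewrite inE /= => uv ->; rewrite cards2.
by case: eqP uv => // ->; rewrite arc_irrefl.
Qed.

Definition arc_graph := SGraph arc_edgesP.

(** By asymmetry exactly one orientation of an edge is an arc, so the sum has a single term. *)
Definition arc_weights (c : V -> V -> R) : {ffun edge arc_graph -> R} :=
  [ffun a => \sum_(e : V * V | arc e.1 e.2 && ([set e.1; e.2]%SET == val a))
               c e.1 e.2].

Lemma adj_arc u v : adj arc_graph u v = arc u v || arc v u.
Proof.
apply/imsetP/orP => [[[a b]]|[uv|vu]].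
- by rewrite inE /= => ab /esym/(set2_arc ab)[[<- <-]|[<- <-]]; auto.
- by exists (u, v); rewrite ?inE.
- by exists (v, u); rewrite ?inE //= finset.setUC.
Qed.

Lemma pair_weight_arc c u v :
  arc u v -> pair_weight (arc_weights c) u v = c u v.
Proof.
move=> uv; rewrite /pair_weight.
have uvE : [set u; v]%SET \in edges arc_graph.
  by apply/imsetP; exists (u, v); rewrite ?inE.
rewrite insubT ffunE (big_pred1 (u, v)) // => -[a b] /=.
apply/andP/eqP => [[ab /eqP/(set2_arc ab)[//|[aE bE]]]|[-> ->]]; last by rewrite eqxx.
by move: ab; rewrite aE bE (negPf (arc_asym uv)).
Qed.

Lemma pair_weightC c u v :
  pair_weight (arc_weights c) u v = pair_weight (arc_weights c) v u.
Proof. by rewrite /pair_weight finset.setUC. Qed.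

Lemma nonneg_arc_weights c :
  (forall u v, arc u v -> 0 <= c u v) -> nonneg_weights (arc_weights c).
Proof. by move=> c0 a; rewrite ffunE; apply: sumr_ge0 => e /andP[/c0]. Qed.

Lemma neighbors_arc_weights c c' :
  \sum_(e : V * V | arc e.1 e.2) `|c e.1 e.2 - c' e.1 e.2| <= 1 ->
  neighbors (arc_weights c) (arc_weights c').
Proof.
apply: le_trans; under eq_bigr do rewrite !ffunE -sumrB.
apply: le_trans (ler_sum _ (fun a _ => ler_norm_sum _ _ _)) _.
rewrite (exchange_big_dep (fun e : V * V => arc e.1 e.2)) /=; last first.
  by move=> a e _ /andP[].
apply: ler_sum => e ae.
have eE : [set e.1; e.2]%SET \in edges arc_graph.
  by apply/imsetP; exists e; rewrite ?inE.
rewrite (big_pred1 (Sub [set e.1; e.2]%SET eE)) // => a.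
by rewrite /= ae -val_eqE eq_sym.
Qed.

End ArcGraph.

(** * Incidences of points and lines in the grid *)

Section Grid.
Context {R : realType} (l : nat).
Notation L := l.+1.
Notation point := ('I_L * 'I_(2 * L ^ 2))%type.
Notation line := ('I_(L ^ 2) * 'I_L)%type.
Notation ell := (L%:R : R).
Implicit Types (p : point) (q : line) (x : {ffun point -> bool}).

Definition height q (i : nat) : nat := (q.1 + q.2 * i)%N.

Definition inc q p : bool := p.2 == height q p.1 :> nat.

Lemma height_lt q (i : 'I_L) : (height q i < 2 * L ^ 2)%N.
Proof. by rewrite /height; case: q i => -[a ha] [s hs] [i hi] /=; nia. Qed.

Definition line_point q (i : 'I_L) : point := (i, Ordinal (height_lt q i)).

Lemma sum_inc q (f : point -> R) :
  \sum_(p | inc q p) f p = \sum_i f (line_point q i).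
Proof.
rewrite (reindex (line_point q)) /=.
  by apply: eq_bigl => i; rewrite /inc /= eqxx.
exists fst => [i _|[i y]] //; rewrite inE => /eqP /= yE.
by congr pair; apply/val_inj.
Qed.

Lemma sum_incM q (f : point -> R) :
  \sum_p (inc q p)%:R * f p = \sum_i f (line_point q i).
Proof.
rewrite -sum_inc [RHS]big_mkcond; apply: eq_bigr => p _.
by case: ifP; rewrite ?mul1r ?mul0r.
Qed.

Lemma sum_bool_le1 (T : finType) (B : pred T) :
  (forall t t', B t -> B t' -> t = t') -> \sum_t (B t)%:R <= 1 :> R.
Proof.
move=> B1; case: (pickP B) => [t Bt|B0].
  rewrite (bigD1 t) //= Bt big1 ?addr0 // => t' /eqP tt'.
  by case Bt' : (B t') => //; case: tt'; apply: B1.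
by rewrite big1 // => t _; rewrite B0.
Qed.

Notation A := (fun q p => (inc q p)%:R : R).

Lemma card_points : #|{: point}|%:R = 2 * ell ^+ 3 :> R.
Proof. by rewrite card_prod !card_ord !natrM ?natrX; ring. Qed.

Lemma card_lines : #|{: line}|%:R = ell ^+ 3 :> R.
Proof. by rewrite card_prod !card_ord !natrM ?natrX; ring. Qed.

Lemma trace_gram_inc : \sum_p gram A p p = ell ^+ 4.
Proof.
rewrite /gram exchange_big /= (eq_bigr (fun=> ell)) => [|q _].
  by rewrite sumr_const -[LHS]mulr_natr card_lines; ring.
by rewrite sum_incM /inc /=; under eq_bigr do rewrite eqxx; rewrite sumr_const card_ord.
Qed.

(** At most one line of each slope passes through a point. *)
Lemma gram_inc_diag p : gram A p p <= ell.
Proof.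
apply: le_trans (_ : \sum_(s : 'I_L) \sum_(a : 'I_(L ^ 2)) (inc (a, s) p)%:R <= _).
  rewrite exchange_big pair_bigA /= le_eqVlt; apply/orP; left; apply/eqP.
  by apply: eq_bigr => -[a s] _ /=; case: inc; rewrite ?mulr1 ?mulr0.
rewrite -[leRHS]/(L%:R) -[in leRHS](card_ord L) -sumr_const.
apply: ler_sum => s _; apply: sum_bool_le1 => a b /eqP ha /eqP; rewrite ha => /addIn ab.
exact/val_inj.
Qed.

Lemma gram_inc_offdiag p p' : p != p' -> gram A p p' <= 1.
Proof.
move=> pp'; rewrite /gram; under eq_bigr do rewrite -natrM mulnb.
apply: sum_bool_le1 => -[a s] [b t] /andP[/eqP + /eqP +] /andP[/eqP + /eqP +].
case: p p' pp' => [i y] [i' y']; rewrite /height /= => pp' h1 h2 h3 h4.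
(* Points of one line in the same column coincide; in different columns they determine the slope,
   then the intercept. *)
have ii' : (i != i' :> nat).
  apply: contraNneq pp' => e; apply/eqP; congr pair; apply/val_inj => //=.
  by rewrite h1 h2 e.
have st : (s = t :> nat) by nia.
have ab : (a = b :> nat) by nia.
by congr pair; apply/val_inj.
Qed.

(** Off-diagonal entries are at most 1, so squaring does not increase them, and all entries sum to
    [ell ^+ 5] by counting pairs on each line; the diagonal adds at most [ell] times the trace. *)
Lemma gram_inc_sqr : \sum_p \sum_p' gram A p p' ^+ 2 <= 2 * ell ^+ 5.
Proof.
have gram_ge0 p p' : 0 <= gram A p p' by apply: sumr_ge0 => q _; rewrite mulr_ge0.
have bound p p' : gram A p p' ^+ 2 <= gram A p p' + (p == p')%:R * (ell * gram A p p).
  have := gram_ge0 p p'; have [<-|/gram_inc_offdiag] := eqVneq p p'.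
    by have := gram_inc_diag p; rewrite /=; nra.
  by rewrite /=; nra.
apply: le_trans (ler_sum _ (fun p _ => ler_sum _ (fun p' _ => bound p p'))) _.
have total : \sum_p \sum_p' gram A p p' = ell ^+ 5.
  under eq_bigr do rewrite exchange_big /=.
  rewrite exchange_big /=.
  rewrite (eq_bigr (fun=> ell * ell)) => [|q _].
    by rewrite sumr_const -[LHS]mulr_natr card_lines; ring.
  have cardq : \sum_p (inc q p)%:R = ell.
    by under eq_bigr do rewrite -[(_)%:R]mulr1; rewrite sum_incM sumr_const card_ord.
  by rewrite -[in RHS]cardq big_distrlr.
under eq_bigr do rewrite big_split /=.
rewrite big_split /= total.
rewrite [X in _ + X](eq_bigr (fun p => ell * gram A p p)) => [|p _].
  by rewrite -mulr_sumr trace_gram_inc; lra.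
rewrite (bigD1 p) //= eqxx big1 ?addr0 ?mul1r // => p'.
by rewrite eq_sym => /negPf ->; rewrite mul0r.
Qed.

Lemma answer_inc x q :
  answer A x q = ell - 2 * \sum_i (x (line_point q i))%:R.
Proof.
rewrite /answer sum_incM; under eq_bigr do rewrite chiE.
by rewrite sumrB sumr_const card_ord mulr_sumr.
Qed.

End Grid.

(** * The weighted grid graph and its geodesics *)

Section GridGraph.
Context {R : realType} (l : nat).
Notation L := l.+1.
Notation point := ('I_L * 'I_(2 * L ^ 2))%type.
Notation line := ('I_(L ^ 2) * 'I_L)%type.
Notation vertex := (point * bool)%type.
Notation ell := (L%:R : R).
Implicit Types (p : point) (q : line) (x : {ffun point -> bool}) (u v : vertex).

(* Every point is split into an entry (p, false) and an exit (p, true). *)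
Definition grid_arc u v : bool :=
  if u.2 then [&& ~~ v.2, v.1.1 == u.1.1.+1 :> nat & u.1.2 <= v.1.2 < u.1.2 + L]%N
  else v.2 && (u.1 == v.1).

Lemma grid_arc_asym u v : grid_arc u v -> ~~ grid_arc v u.
Proof.
case: u v => [[i y] []] [[j z] []] //=; rewrite /grid_arc /=.
  move=> /andP[/eqP ij _]; apply/eqP => -[ji _].
  by move: ij; rewrite ji; lia.
by move=> /eqP[-> _]; apply/negP => /andP[/eqP]; lia.
Qed.

(* The quadratic cost makes the straight line the cheapest way to distribute a
   given total slope over the columns; the constant forbids steps backwards. *)
Definition grid_cost x u v : R :=
  if u.2 then ell * (ell ^+ 2 + 1) + ell * (v.1.2%:R - u.1.2%:R) ^+ 2
  else (x u.1)%:R.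

Definition line_prefix x q (j : nat) : R :=
  \sum_(i < L | (i < j)%N) (x (line_point q i))%:R.

(** With s the slope [q.2], the tangent at t = s of the step cost
    [ell * (ell ^+ 2 + 1) + ell * t ^+ 2] is [line_slope q + 2 * ell * s * t]. *)
Definition line_slope q : R := ell * (ell ^+ 2 + 1) - ell * q.2%:R ^+ 2.

(** Across a column step the affine part grows by the tangent value, at most the cost by convexity.
    The last term counts the bits passed on the line; at an exit, [u.2] includes the current one. *)
Definition line_potential x q u : R :=
  u.1.1%:R * line_slope q + 2 * ell * q.2%:R * u.1.2%:R
  + (if inc q u.1 then line_prefix x q (u.1.1 + u.2) else 0).

Lemma line_prefixS x q p : inc q p ->
  line_prefix x q p.1.+1 = line_prefix x q p.1 + (x p)%:R.
Proof.
case: p => i y /eqP /= yE; rewrite /line_prefix (bigD1 i) //= addrC.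
congr (_ + (x _)%:R); last by congr pair; apply/val_inj.
by apply: eq_bigl => j; rewrite -val_eqE /= ltnS ltn_neqAle andbC.
Qed.

Lemma line_prefix_bounds x q j : 0 <= line_prefix x q j <= ell.
Proof.
rewrite sumr_ge0 //=; apply: le_trans (_ : \sum_(i < L) 1 <= _).
  rewrite [leRHS](bigID (fun i : 'I_L => (i < j)%N)) /= -[leLHS]addr0.
  apply: lerD; last exact: sumr_ge0.
  by apply: ler_sum => i _; case: (x _).
by rewrite sumr_const card_ord.
Qed.

(** A step t other than the slope s costs [ell * (t - s) ^+ 2 >= ell] above the tangent, which pays
    for a jump of the prefix term. The absolute value covers both orientations of the edge. *)
Lemma line_potential_arc x q u v : grid_arc u v ->
  `|line_potential x q v - line_potential x q u| <= grid_cost x u v.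
Proof.
case: u v => [[i y] []] [[j z] []] //=; rewrite /grid_arc /grid_cost /line_potential /=.
  move=> /andP[/eqP ij /andP[yz zy]].
  rewrite ij addn0 addn1 -natr1.
  set g := (if inc q (j, z) then _ else _); set g' := (if _ then _ else _).
  have /andP[pr0 prL] := line_prefix_bounds x q i.+1.
  have [g0 gL] : 0 <= g /\ g <= ell by rewrite /g; case: ifP; split; lra.
  have [g'0 g'L] : 0 <= g' /\ g' <= ell by rewrite /g'; case: ifP; split; lra.
  have ell1 : 1 <= ell by rewrite ler1n.
  have s0 : 0 <= q.2%:R :> R by [].
  have sL : q.2%:R <= ell :> R by rewrite ler_nat ltnW.
  (* A step along the slope starts on the line exactly when it ends there, so the prefix terms
     agree. *)
  have [tE|tN] := eqVneq (z : nat) (y + q.2)%N.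
    have gg : g = g'.
      by rewrite /g /g' /inc /height /= tE ij mulnS addnCA [(q.2 + _)%N]addnC eqn_add2r.
    rewrite gg tE natrD /line_slope ler_norml.
    by apply/andP; split; nra.
  have t2 : 1 <= (z%:R - y%:R - q.2%:R) ^+ 2 :> R.
    have [lt|gt] := ltnP z (y + q.2).
      have : (z.+1)%:R <= (y + q.2)%:R :> R by rewrite ler_nat.
      by rewrite -natr1 natrD; nra.
    have : ((y + q.2).+1)%:R <= z%:R :> R by rewrite ler_nat ltn_neqAle eq_sym tN.
    by rewrite -natr1 natrD; nra.
  rewrite /line_slope.
  move: t2 s0 sL; move: (z%:R) (y%:R) (q.2%:R) => Z Y s t2 s0 sL.
  have s2 : s ^+ 2 <= ell ^+ 2 by rewrite lerXn2r // nnegrE; lra.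
  have /(ler_wpM2l (ler0n R L)) es2 := s2.
  have /(ler_wpM2l (ler0n R L)) et2 := t2.
  (* Used against the arc, where the constant [ell * (ell ^+ 2 + 1)] outweighs the terms in [s] and
     the prefix jump. *)
  have et := mulr_ge0 (ler0n R L) (sqr_ge0 (Z - Y + s)).
  rewrite ler_norml; apply/andP; split; lra.
move=> /eqP[-> ->]; rewrite addn0 addn1.
case: ifP => [/(line_prefixS x) /= ->|_]; last by rewrite subrr normr0.
by rewrite opprD addrACA subrr add0r [line_prefix _ _ _ + _]addrC addrK normr_nat.
Qed.

(** Even indices are entries and odd ones exits, so the path ends at index [L.*2.-1]. *)
Definition line_vertex q (j : nat) : vertex := (line_point q (inord j./2), odd j).

(** The public part of the length: it cancels when two weightings are compared. *)
Definition line_base q : R :=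
  l%:R * line_slope q + 2 * ell * q.2%:R * (q.2 * l)%:R.

Lemma line_vertex_inj q i j : (i <= L.*2.-1)%N -> (j <= L.*2.-1)%N ->
  line_vertex q i = line_vertex q j -> i = j.
Proof.
move=> iL jL [/(congr1 val) /= + _ oij]; rewrite !inordK; lia.
Qed.

Lemma line_vertex_arc q j : (j < L.*2.-1)%N ->
  grid_arc (line_vertex q j) (line_vertex q j.+1).
Proof.
move=> jL; rewrite /grid_arc /line_vertex /= uphalf_half /height.
case: (boolP (odd j)) => oj /=; last by rewrite eqxx.
rewrite /height !inordK; try lia.
by rewrite eqxx /= mulnS; have := ltn_ord q.2; lia.
Qed.

Lemma line_vertex_tight x q j : (j < L.*2.-1)%N ->
  grid_cost x (line_vertex q j) (line_vertex q j.+1) =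
  line_potential x q (line_vertex q j.+1) - line_potential x q (line_vertex q j).
Proof.
move=> jL; rewrite /grid_cost /line_potential /line_vertex /= uphalf_half.
have onl i : inc q (line_point q i) by rewrite /inc.
rewrite !onl; case: (boolP (odd j)) => oj /=.
  rewrite /height !inordK; try lia.
  by rewrite addn1 addn0 add1n mulnS !natrD -natr1 /line_slope; ring.
have /(line_prefixS x) /= := onl (inord j./2).
by rewrite add0n addn0 addn1 => ->; ring.
Qed.

Lemma line_potential_ends x q :
  line_potential x q (line_vertex q L.*2.-1) - line_potential x q (line_vertex q 0)
  = line_base q + \sum_i (x (line_point q i))%:R.
Proof.
rewrite /line_potential /line_vertex.
have onl i : inc q (line_point q i) by rewrite /inc.
rewrite !onl /= /height !inordK //; last by lia.
have -> : uphalf l.*2 = l by rewrite uphalf_double.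
have -> : ~~ odd l.*2 by rewrite odd_double.
rewrite /line_prefix addn0 addn1 /= [X in _ - (_ + X)]big_pred0 //.
rewrite (eq_bigl xpredT) => [|i]; last by rewrite ltn_ord.
by rewrite /line_base muln0 addn0 natrD; ring.
Qed.

Definition coded_arc : rel 'I_#|{: vertex}| :=
  fun a b => grid_arc (enum_val a) (enum_val b).

Lemma coded_arc_asym (u v : 'I_#|{: vertex}|) : coded_arc u v -> ~~ coded_arc v u.
Proof. exact: grid_arc_asym. Qed.

Definition grid_graph : sgraph 'I_#|{: vertex}| := arc_graph coded_arc_asym.

Definition grid_weights x : {ffun edge grid_graph -> R} :=
  arc_weights coded_arc_asym
    (fun a b => grid_cost x (enum_val a) (enum_val b)).

Lemma dist_line x q :
  dist (grid_weights x) (enum_rank (line_vertex q 0))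
    (enum_rank (line_vertex q L.*2.-1))
  = (line_base q + \sum_i (x (line_point q i))%:R)%:E.
Proof.
rewrite -line_potential_ends.
have := @dist_tight_path R _ grid_graph (grid_weights x)
  (fun a => line_potential x q (enum_val a)) _
  (fun j => enum_rank (line_vertex q j)) L.*2.-1.
rewrite !enum_rankK; apply.
- move=> u v; rewrite adj_arc => /orP[] uv.
    rewrite pair_weight_arc //; apply: le_trans (ler_norm _) _.
    exact: line_potential_arc.
  rewrite pair_weightC pair_weight_arc //; apply: le_trans (ler_norm _) _.
  by rewrite distrC; exact: line_potential_arc.
- by move=> i j iL jL /enum_rank_inj; exact: line_vertex_inj.
- by move=> i iL; rewrite adj_arc /coded_arc !enum_rankK line_vertex_arc.
- move=> i iL; rewrite pair_weight_arc /coded_arc !enum_rankK ?line_vertex_arc //.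
  exact: line_vertex_tight.
Qed.

Lemma grid_weights_ge0 x : nonneg_weights (grid_weights x).
Proof.
apply: nonneg_arc_weights => u v _; rewrite /grid_cost; case: ifP => // _.
by apply: addr_ge0; apply: mulr_ge0; rewrite ?addr_ge0 ?sqr_ge0.
Qed.

Lemma grid_weights_flip x p : neighbors (grid_weights x) (grid_weights (flip p x)).
Proof.
apply: neighbors_arc_weights.
(* Only the edge from the entry to the exit of [p] carries its bit. *)
pose e0 := (enum_rank (p, false), enum_rank (p, true)).
rewrite (bigD1 e0) /=; last by rewrite /coded_arc !enum_rankK /grid_arc /= eqxx.
rewrite big1 ?addr0 => [|[u v] /andP[]].
  rewrite /grid_cost !enum_rankK /= ffunE eqxx.
  by case: (x p); rewrite /= ?subr0 ?sub0r ?normrN normr1.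
rewrite /e0 xpair_eqE /grid_cost /coded_arc /grid_arc /=.
rewrite -[u]enum_valK -[v]enum_valK !(inj_eq enum_rank_inj) !enum_rankK.
case: (enum_val u) (enum_val v) => [pu []] [pv b] /=; first by rewrite subrr normr0.
move=> /andP[bE /eqP <-]; rewrite bE !xpair_eqE andbT andbb ffunE eq_sym => /negPf ->.
by rewrite subrr normr0.
Qed.

(** A common estimate forces the bit counts to differ by at most [2 * alpha]; an answer is a
    constant minus twice the count. *)
Lemma answer_close x y q d alpha :
  accurate (grid_weights x) alpha d -> accurate (grid_weights y) alpha d ->
  `|answer (fun q p => (inc q p)%:R : R) x q
    - answer (fun q p => (inc q p)%:R) y q| <= 4 * alpha.
Proof.
move=> /(_ (enum_rank (line_vertex q 0)) (enum_rank (line_vertex q L.*2.-1))).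
rewrite dist_line => /(_ (ltry _)); rewrite lee_fin => hx.
move=> /(_ (enum_rank (line_vertex q 0)) (enum_rank (line_vertex q L.*2.-1))).
rewrite dist_line => /(_ (ltry _)); rewrite lee_fin => hy.
rewrite !answer_inc; move: hx hy; rewrite !ler_norml => /andP[? ?] /andP[? ?].
apply/andP; split; lra.
Qed.

End GridGraph.

(** * Choice of parameters and conclusion *)

Lemma powR_sixth_sqr (R : realType) (l : nat) :
  (#|{: 'I_l.+1 * 'I_(2 * l.+1 ^ 2) * bool}|%:R `^ 6%:R^-1) ^+ 2 <= 4 * l.+1%:R :> R.
Proof.
set n := #|_|; pose s : R := n%:R `^ 6%:R^-1.
have nE : n%:R = 4 * l.+1%:R ^+ 3 :> R.
  by rewrite /n card_prod card_bool natrM card_points; ring.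
have s6 : s ^+ 6 = 4 * l.+1%:R ^+ 3.
  by rewrite -powR_mulrn ?powR_ge0 // -powRrM mulVf // powRr1.
have s2 : (s ^+ 2) ^+ 3 <= (4 * l.+1%:R) ^+ 3.
  rewrite -exprM s6 exprMn ler_wpM2r ?exprn_ge0 //.
  by rewrite -[leLHS]expr1 ler_eXn2l // ltr1n.
by move: s2; rewrite ler_pXn2r // nnegrE ?sqr_ge0 ?mulr_ge0.
Qed.

Theorem theorem1p3 (R : realType) (beta : R) (hbeta : 0 < beta < 1) :
  exists eps0 delta0 : R, [/\ 0 < eps0, 0 < delta0 &
    forall eps delta : R, 0 < eps <= eps0 -> 0 < delta <= delta0 ->
    ~ exists (alpha : nat -> R^o)
             (M : forall (n : nat) (G : sgraph 'I_n), algorithm R G),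
        alpha =o_\oo ((fun n : nat => n%:R `^ (6%:R^-1)) : nat -> R^o) /\
        forall (n : nat) (G : sgraph 'I_n),
          DP eps delta (M n G) /\
          forall w : {ffun edge G -> R}, nonneg_weights w ->
            ((1 - beta)%:E <= M n G w (accurate w (alpha n)))%E].
Proof.
case/andP: hbeta => beta_gt0 beta_lt1.
(* [kappa] is the constant of [reconstruction_bound]. *)
pose p := 1 - beta; pose kappa := p ^+ 3 / 2 ^+ 19.
have p_gt0 : 0 < p by rewrite subr_gt0.
have p_le1 : p <= 1 by rewrite lerBlDr lerDl ltW.
have kappa_gt0 : 0 < kappa by rewrite divr_gt0 ?exprn_gt0.
have kappa_le : kappa <= p.
  rewrite ler_pdivrMr ?exprn_gt0 //; apply: le_trans (_ : p ^+ 1 <= _).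
    by rewrite ler_wiXn2l // ltW.
  by rewrite expr1 ler_peMr ?(ltW p_gt0) // exprn_ege1 // ler1n.
(* Then [expR eps - 1 + delta] is at most [kappa / 8], and four times it at most [kappa / 2]. *)
exists (ln (1 + kappa / 16)), (kappa / 16).
split; [by rewrite ln_gt0 // ltrDl divr_gt0 | by rewrite divr_gt0 |].
move=> eps delta /andP[eps_gt0 eps_le] /andP[delta_gt0 delta_le].
move=> [alpha [M [/eqoP alpha_o M_ok]]].
(* With the factor 1/16, [(4 * alpha n) ^+ 2] is at most n^(1/3) / 16, hence at most [ell / 4]. *)
have sixteenth_gt0 : 0 < 16^-1 :> R by rewrite invr_gt0.
have [n0 _ alpha_small] := alpha_o _ sixteenth_gt0.
(* The first term puts [n] beyond [n0]; the second gives [64 < kappa * ell]. *)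
pose l := maxn n0 (Num.truncn (64 / kappa)).+1.
pose ell : R := l.+1%:R.
pose n := #|{: 'I_l.+1 * 'I_(2 * l.+1 ^ 2) * bool}|.
have n0n : (n0 <= n)%N.
  rewrite /n !card_prod card_bool !card_ord.
  apply: leq_trans (leq_maxl _ _ : (n0 <= l)%N) (leq_trans (leqnSn l) _).
  by rewrite -mulnA leq_pmulr // !muln_gt0 expn_gt0.
have ell_large : 64 < kappa * ell.
  rewrite mulrC -ltr_pdivrMr //; apply: lt_le_trans (truncnS_gt _) _.
  by rewrite ler_nat; apply: leq_trans (leq_maxr _ _) (leqnSn _).
have ell_ge1 : 1 <= ell by rewrite ler1n.
have ell3 : ell <= ell ^+ 3 by rewrite ler_eXnr.
have eps_bound : expR eps - 1 <= kappa / 16.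
  rewrite lerBlDl -[leRHS]lnK ?ler_expR //.
  by rewrite posrE addr_gt0 // divr_gt0.
have [dpM accM] := M_ok n (grid_graph l).
have [P [consistent [P_ge0 P_le1 P_flip close P_acc]]] :=
  dp_finite_outputs (ltW eps_gt0) dpM (@grid_weights_ge0 R l)
    (@grid_weights_flip R l) (fun x => accM _ (grid_weights_ge0 x)).
have tau_ge0 : 0 <= expR eps - 1 + delta.
  by rewrite addr_ge0 ?(ltW delta_gt0) // subr_ge0 -expR0 ler_expR ltW.
have rho_small : (4 * alpha n) ^+ 2 <= ell / 2.
  have := alpha_small n n0n; rewrite /= => an.
  have : `|alpha n| ^+ 2 <= (16^-1 * `|n%:R `^ 6%:R^-1|) ^+ 2.
    by rewrite lerXn2r // nnegrE mulr_ge0 // invr_ge0.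
  rewrite exprMn !real_normK ?num_real //.
  by have := powR_sixth_sqr R l; rewrite -/n -/ell; lra.
have := @reconstruction_bound R _ _ _ (fun q p => (inc q p)%:R) ell p
  (expR eps - 1 + delta) (4 * alpha n) P consistent _ p_gt0 p_le1 tau_ge0 _
  (card_points l) (card_lines l) (trace_gram_inc l) (gram_inc_sqr l)
  P_ge0 P_le1 P_flip _ rho_small P_acc.
rewrite -/kappa => bound.
have {bound} : kappa * ell ^+ 3 <= 4 * (expR eps - 1 + delta) * ell ^+ 3 + 2.
  apply: bound => //.
  - move=> k x y q kx ky; have [d [dx dy]] := close k x y kx ky.
    exact: answer_close dx dy.
  - nra.
(* The bound leaves [kappa * ell ^+ 3 <= 4], against [64 < kappa * ell <= kappa * ell ^+ 3]. *)
nra.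
Qed.
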